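(* Let $a, b, c \in \mathbb{Q}$ be quaternions, not all zero, and let $$Z = \begin{bmatrix} 0 & a & c \\ -a & 0 & b \\ -c & -b & 0 \end{bmatrix} \in \mathbb{Q}^{3\times 3}.$$ Let $W = -Z\bar Z = ZZ^*$. Then $W$ has three positive right eigenvalues (counted with multiplicity) if and only if $a \neq 0$ and $$c a^{-1} b \neq b a^{-1} c.$$ Otherwise, $W$ has a zero right eigenvalue and a double positive right eigenvalue $|a|^2 + |b|^2 + |c|^2$.
   Context: $\mathbb{Q}$ denotes the (noncommutative) real quaternions $q = q_0 + q_1\mathbf{i} + q_2\mathbf{j} + q_3\mathbf{k}$, with $q_0,\dots,q_3 \in \mathbb{R}$; $\bar q = q_0 - q_1\mathbf{i} - q_2\mathbf{j} - q_3\mathbf{k}$ is the quaternion conjugate and $|q| = \sqrt{q_0^2+q_1^2+q_2^2+q_3^2}$. For a quaternion matrix $A = (a_{ij})$, $A^\top = (a_{ji})$ is the transpose, $\bar A = (\bar a_{ij})$ is the entrywise conjugate, and $A^* = (\bar a_{ji}) = \bar A^\top$ is the conjugate transpose. $A$ is Hermitian if $A^* = A$. A quaternion $\lambda$ is a right eigenvalue of $A \in \mathbb{Q}^{n\times n}$ if $A\mathbf{x} = \mathbf{x}\lambda$ for some nonzero $\mathbf{x} \in \mathbb{Q}^n$. A Hermitian $A \in \mathbb{Q}^{n\times n}$ has exactly $n$ real right eigenvalues counted with multiplicity, namely $\lambda_1 \ge \cdots \ge \lambda_n$ such that $U^*AU = \mathrm{diag}(\lambda_1,\dots,\lambda_n)$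 for some unitary $U \in \mathbb{Q}^{n\times n}$ (i.e. $U^*U = I$). Right eigenvalues of Hermitian matrices are counted with multiplicity in this sense, and ''double'' means multiplicity two. *)

(* Defs.v *)
From HB Require Import structures.
From mathcomp Require Import all_boot all_order all_algebra.
From mathcomp Require Import reals.
From mathcomp Require Import ring.

Set Implicit Arguments.
Unset Strict Implicit.
Unset Printing Implicit Defensive.

Import Order.TTheory GRing.Theory Num.Theory.
Local Open Scope ring_scope.

Record quat (R : Type) := Quat { qc0 : R; qc1 : R; qc2 : R; qc3 : R }.

Definition quat_enc (R : Type) (q : quat R) := (qc0 q, qc1 q, qc2 q, qc3 q).
Definition quat_dec (R : Type) (t : R * R * R * R) :=
  let: (w, x, y, z) := t in Quat w x y z.

Lemma quat_encK (R : Type) : cancel (@quat_enc R) (@quat_dec R).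
Proof. by case. Qed.

HB.instance Definition _ (R : choiceType) :=
  Choice.copy (quat R) (can_type (@quat_encK R)).

Section QuatAlgebra.
Variable R : realFieldType.
Implicit Types p q r : quat R.

Lemma quatP p q :
  qc0 p = qc0 q -> qc1 p = qc1 q -> qc2 p = qc2 q -> qc3 p = qc3 q -> p = q.
Proof. by case: p q => [????] [????] /= -> -> -> ->. Qed.

Definition zero_quat : quat R := Quat 0 0 0 0.
Definition one_quat : quat R := Quat 1 0 0 0.
Definition opp_quat q := Quat (- qc0 q) (- qc1 q) (- qc2 q) (- qc3 q).
Definition add_quat p q :=
  Quat (qc0 p + qc0 q) (qc1 p + qc1 q) (qc2 p + qc2 q) (qc3 p + qc3 q).

(* Hamilton's product: i^2 = j^2 = k^2 = ijk = -1. *)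
Definition mul_quat p q :=
  Quat (qc0 p * qc0 q - qc1 p * qc1 q - qc2 p * qc2 q - qc3 p * qc3 q)
       (qc0 p * qc1 q + qc1 p * qc0 q + qc2 p * qc3 q - qc3 p * qc2 q)
       (qc0 p * qc2 q - qc1 p * qc3 q + qc2 p * qc0 q + qc3 p * qc1 q)
       (qc0 p * qc3 q + qc1 p * qc2 q - qc2 p * qc1 q + qc3 p * qc0 q).

Definition conj_quat q := Quat (qc0 q) (- qc1 q) (- qc2 q) (- qc3 q).
Definition sqnorm_quat q := qc0 q ^+ 2 + qc1 q ^+ 2 + qc2 q ^+ 2 + qc3 q ^+ 2.
Definition real_quat (x : R) : quat R := Quat x 0 0 0.

Definition inv_quat q := mul_quat (real_quat (sqnorm_quat q)^-1) (conj_quat q).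

Lemma addqA : associative add_quat.
Proof. by move=> p q r; apply: quatP => /=; ring. Qed.
Lemma addqC : commutative add_quat.
Proof. by move=> p q; apply: quatP => /=; ring. Qed.
Lemma add0q : left_id zero_quat add_quat.
Proof. by move=> p; apply: quatP => /=; ring. Qed.
Lemma addNq : left_inverse zero_quat opp_quat add_quat.
Proof. by move=> p; apply: quatP => /=; ring. Qed.

HB.instance Definition _ :=
  GRing.isZmodule.Build (quat R) addqA addqC add0q addNq.

Lemma mulqA : associative mul_quat.
Proof. by move=> p q r; apply: quatP => /=; ring. Qed.
Lemma mul1q : left_id one_quat mul_quat.
Proof. by move=> p; apply: quatP => /=; ring. Qed.
Lemma mulq1 : right_id one_quat mul_quat.
Proof. by move=> p; apply: quatP => /=; ring. Qed.
Lemma mulqDl : left_distributive mul_quat add_quat.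
Proof. by move=> p q r; apply: quatP => /=; ring. Qed.
Lemma mulqDr : right_distributive mul_quat add_quat.
Proof. by move=> p q r; apply: quatP => /=; ring. Qed.
Lemma oneq_neq0 : one_quat != 0.
Proof. by apply/eqP => -[] /eqP; rewrite oner_eq0. Qed.

HB.instance Definition _ := GRing.Zmodule_isNzRing.Build (quat R)
  mulqA mul1q mulq1 mulqDl mulqDr oneq_neq0.

Lemma sqnormq_eq0 q : (sqnorm_quat q == 0) = (q == 0).
Proof.
apply/idP/eqP => [|->]; last by rewrite /sqnorm_quat /= !expr0n /= !addr0.
rewrite /sqnorm_quat !paddr_eq0 ?addr_ge0 ?sqr_ge0 // !sqrf_eq0.
by move=> /andP[/andP[/andP[/eqP h0 /eqP h1] /eqP h2] /eqP h3]; apply: quatP.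
Qed.

Definition unit_quat : pred (quat R) := fun q => q != 0.

Lemma mulVq : {in unit_quat, left_inverse (1 : quat R) inv_quat *%R}.
Proof.
move=> q; rewrite unfold_in /unit_quat -sqnormq_eq0 /sqnorm_quat => h.
by apply: quatP; rewrite /= /sqnorm_quat; field.
Qed.

Lemma mulqV : {in unit_quat, right_inverse (1 : quat R) inv_quat *%R}.
Proof.
move=> q; rewrite unfold_in /unit_quat -sqnormq_eq0 /sqnorm_quat => h.
by apply: quatP; rewrite /= /sqnorm_quat; field.
Qed.

Lemma unitqP p q : q * p = 1 /\ p * q = 1 -> unit_quat p.
Proof.
by case=> h _; apply/eqP => p0; move: h; rewrite p0 mulr0 => /esym/eqP;
   rewrite oner_eq0.
Qed.

Lemma invq_out : {in [predC unit_quat], inv_quat =1 id}.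
Proof.
by move=> q; rewrite inE /= unfold_in /unit_quat negbK => /eqP ->; apply: quatP => /=; ring.
Qed.

HB.instance Definition _ :=
  GRing.NzRing_hasMulInverse.Build (quat R) mulVq mulqV unitqP invq_out.

End QuatAlgebra.

Definition norm_quat (R : rcfType) (q : quat R) : R := Num.sqrt (sqnorm_quat q).

Section QuatMatrices.
Variable R : realFieldType.

Definition quat_conjmx m n (A : 'M[quat R]_(m, n)) : 'M[quat R]_(m, n) :=
  map_mx (@conj_quat R) A.

Definition quat_adjmx m n (A : 'M[quat R]_(m, n)) : 'M[quat R]_(n, m) :=
  (quat_conjmx A)^T.

Definition quat_unitarymx n (U : 'M[quat R]_n) : Prop := quat_adjmx U *m U = 1%:M.

Definition right_eigenvalue n (A : 'M[quat R]_n) (lambda : quat R) : Prop :=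
  exists2 x : 'cV[quat R]_n, x != 0 & A *m x = \col_i (x i 0 * lambda).

(* [l] lists, in nonincreasing order and with multiplicity, the real right
   eigenvalues of a Hermitian matrix [A].  A noncommutative base ring has no
   characteristic polynomial, so multiplicity is read off a unitary
   diagonalization. *)
Definition right_eigenvalues_with_mult n (A : 'M[quat R]_n) (l : 'rV[R]_n) :
    Prop :=
  [/\ forall i, right_eigenvalue A (real_quat (l 0 i)),
      forall i j : 'I_n, (i <= j)%N -> l 0 j <= l 0 i
    & exists2 U : 'M[quat R]_n, quat_unitarymx U
        & quat_adjmx U *m A *m U = diag_mx (map_mx (@real_quat R) l)].

Definition skewmx3 (a b c : quat R) : 'M[quat R]_3 :=
  \matrix_(i < 3, j < 3)
    (nth [::] [:: [::   0;   a; c];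
                  [:: - a;   0; b];
                  [:: - c; - b; 0]] i)`_j.

End QuatMatrices.

(* Main.v *)
Require Import Defs.
From HB Require Import structures.
From mathcomp Require Import all_boot all_order all_fingroup all_algebra.
From mathcomp Require Import boolp reals complex ring.

Import Order.TTheory GRing.Theory Num.Theory.
Local Open Scope ring_scope.

(* Eliminating two unknowns shows that, for [a <> 0], [Z^* x = 0] has a nonzero
   solution iff [c a^-1 b = b a^-1 c]; for [a = 0] it always has one.  If [Z^*]
   is injective, every right eigenvalue of [W = Z Z^*] is positive, because
   [x^* W x = |Z^* x|^2].  Otherwise [s - W], with [s = |a|^2 + |b|^2 + |c|^2],
   has rank one: it is [s x x^*] for a unit vector [x], and a Householder
   reflection sending a basis vector to a multiple of [x] diagonalizes [W] as
   [s, s, 0].  The existence of the diagonalization in the first case is the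
   spectral theorem for Hermitian quaternion matrices, proved by deflation from
   an eigenvector of the [2n x 2n] complex matrix representing left
   multiplication by [W]. *)

(** * Conjugation, adjoints and norms over the quaternions *)

Section QuatTheory.
Set Implicit Arguments.
Unset Strict Implicit.
Variable R : realFieldType.
Implicit Types (p q : quat R) (x y : R).

Lemma conj_quat_is_zmod_morphism : zmod_morphism (@conj_quat R).
Proof. by move=> p q; apply: quatP => /=; ring. Qed.
HB.instance Definition _ := GRing.isZmodMorphism.Build (quat R) (quat R)
  (@conj_quat R) conj_quat_is_zmod_morphism.

Lemma conj_quatM p q : conj_quat (p * q) = conj_quat q * conj_quat p.
Proof. by apply: quatP => /=; ring. Qed.

Lemma conj_quatK : involutive (@conj_quat R).
Proof. by move=> p; apply: quatP => /=; ring. Qed.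

Lemma conj_real_quat x : conj_quat (real_quat x) = real_quat x.
Proof. by apply: quatP => /=; ring. Qed.

Lemma real_quat_is_zmod_morphism : zmod_morphism (@real_quat R).
Proof. by move=> x y; apply: quatP => /=; ring. Qed.
HB.instance Definition _ := GRing.isZmodMorphism.Build R (quat R)
  (@real_quat R) real_quat_is_zmod_morphism.

Lemma real_quat_is_monoid_morphism : monoid_morphism (@real_quat R).
Proof. by split=> [|x y]; apply: quatP => /=; ring. Qed.
HB.instance Definition _ := GRing.isMonoidMorphism.Build R (quat R)
  (@real_quat R) real_quat_is_monoid_morphism.

Lemma real_quatC x p : real_quat x * p = p * real_quat x.
Proof. by apply: quatP => /=; ring. Qed.

Lemma real_quatMM x y p q :
  (real_quat x * p) * (real_quat y * q) = real_quat (x * y) * (p * q).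
Proof. by apply: quatP => /=; ring. Qed.

Lemma mul_conj_quat p : conj_quat p * p = real_quat (sqnorm_quat p).
Proof. by apply: quatP; rewrite /= /sqnorm_quat; ring. Qed.

Lemma mul_quat_conj p : p * conj_quat p = real_quat (sqnorm_quat p).
Proof. by apply: quatP; rewrite /= /sqnorm_quat; ring. Qed.

Lemma sqnorm_quat_ge0 p : 0 <= sqnorm_quat p.
Proof. by rewrite /sqnorm_quat !addr_ge0 ?sqr_ge0. Qed.

Lemma sqnorm_quat_gt0 p : (0 < sqnorm_quat p) = (p != 0).
Proof. by rewrite lt_def sqnorm_quat_ge0 sqnormq_eq0 andbT. Qed.

Lemma quat_inv p : p^-1 = real_quat (sqnorm_quat p)^-1 * conj_quat p.
Proof. by []. Qed.

Section Matrices.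
Implicit Types m n k : nat.

Lemma quat_adjmxE m n (A : 'M[quat R]_(m, n)) i j :
  quat_adjmx A i j = conj_quat (A j i).
Proof. by rewrite !mxE. Qed.

Lemma quat_adjmxK m n (A : 'M[quat R]_(m, n)) : quat_adjmx (quat_adjmx A) = A.
Proof. by apply/matrixP => i j; rewrite !mxE conj_quatK. Qed.

Lemma quat_adjmxM m n k (A : 'M[quat R]_(m, n)) (B : 'M[quat R]_(n, k)) :
  quat_adjmx (A *m B) = quat_adjmx B *m quat_adjmx A.
Proof.
apply/matrixP => i j; rewrite !mxE raddf_sum; apply: eq_bigr => l _.
by rewrite /= conj_quatM !mxE.
Qed.

Lemma quat_adjmx_is_zmod_morphism m n :
  zmod_morphism (@quat_adjmx R m n).
Proof. by move=> A B; apply/matrixP => i j; rewrite !mxE raddfB. Qed.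
HB.instance Definition _ m n := GRing.isZmodMorphism.Build
  'M[quat R]_(m, n) 'M[quat R]_(n, m) (@quat_adjmx R m n)
  (@quat_adjmx_is_zmod_morphism m n).

Lemma quat_adjmxZ m n x (A : 'M[quat R]_(m, n)) :
  quat_adjmx (real_quat x *: A) = real_quat x *: quat_adjmx A.
Proof.
by apply/matrixP => i j; rewrite !mxE conj_quatM conj_real_quat real_quatC.
Qed.

Lemma quat_adjmx1 n : quat_adjmx (1%:M : 'M[quat R]_n) = 1%:M.
Proof.
apply/matrixP => i j; rewrite !mxE eq_sym; case: (i == j) => /=.
  by rewrite -[1%:R](rmorph1 (@real_quat R)) conj_real_quat.
exact: raddf0.
Qed.

Lemma quat_adjmx_delta m n i j :
  quat_adjmx (delta_mx i j : 'M[quat R]_(m, n)) = delta_mx j i.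
Proof.
apply/matrixP => i' j'; rewrite !mxE andbC; case: (_ && _) => /=.
  by rewrite -[1%:R](rmorph1 (@real_quat R)) conj_real_quat.
exact: raddf0.
Qed.

(** Scalars act on the left, so moving one past the left factor [A] requires it to be central, as
    real quaternions are. *)
Lemma real_scalemxAr m n k x (A : 'M[quat R]_(m, n)) (B : 'M[quat R]_(n, k)) :
  A *m (real_quat x *: B) = real_quat x *: (A *m B).
Proof.
apply/matrixP => i j; rewrite !mxE mulr_sumr; apply: eq_bigr => l _.
by rewrite mxE !mulrA real_quatC.
Qed.

Lemma quat_mulmx_scalar m n x (A : 'M[quat R]_(m, n)) :
  A *m (real_quat x)%:M = real_quat x *: A.
Proof. by rewrite -scalemx1 real_scalemxAr mulmx1. Qed.

Definition sqnorm_col n (v : 'cV[quat R]_n) : R := \sum_i sqnorm_quat (v i 0).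

Lemma quat_adjmx_mul_col n (v : 'cV[quat R]_n) :
  quat_adjmx v *m v = (real_quat (sqnorm_col v))%:M.
Proof.
apply/matrixP => i j; rewrite !ord1 !mxE mulr1n /sqnorm_col raddf_sum.
by apply: eq_bigr => l _; rewrite quat_adjmxE mul_conj_quat.
Qed.

Lemma sqnorm_col_ge0 n (v : 'cV[quat R]_n) : 0 <= sqnorm_col v.
Proof. by apply: sumr_ge0 => i _; apply: sqnorm_quat_ge0. Qed.

Lemma sqnorm_col_eq0 n (v : 'cV[quat R]_n) : (sqnorm_col v == 0) = (v == 0).
Proof.
rewrite psumr_eq0 => [|i _]; last exact: sqnorm_quat_ge0.
apply/allP/eqP => [v0|-> i _]; last by rewrite /= mxE sqnormq_eq0.
apply/colP => i; rewrite mxE; apply/eqP; rewrite -sqnormq_eq0.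
by apply: v0; rewrite mem_index_enum.
Qed.

Lemma sqnorm_col_gt0 n (v : 'cV[quat R]_n) : (0 < sqnorm_col v) = (v != 0).
Proof. by rewrite lt_def sqnorm_col_ge0 sqnorm_col_eq0 andbT. Qed.

End Matrices.
End QuatTheory.

(** * Quaternion matrices as complex matrices of twice the size *)

Section ComplexRepresentation.
Set Implicit Arguments.
Unset Strict Implicit.
Variable R : rcfType.
Local Notation C := (complex R).
Implicit Types p q : quat R.

(* Every quaternion is [z + j w] for unique complex [z] and [w]; left
   multiplication by a quaternion is then linear for the right action of
   [C]. *)
Definition quat_z q : C := Complex (qc0 q) (qc1 q).
Definition quat_w q : C := Complex (qc2 q) (- qc3 q).
Definition quat_of_complex (z w : C) : quat R :=
  Quat (complex.Re z) (complex.Im z) (complex.Re w) (- complex.Im w).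

Lemma quat_z_is_zmod_morphism : zmod_morphism quat_z.
Proof. by move=> p q. Qed.
HB.instance Definition _ := GRing.isZmodMorphism.Build (quat R) C
  quat_z quat_z_is_zmod_morphism.

Lemma quat_w_is_zmod_morphism : zmod_morphism quat_w.
Proof. by move=> p q; congr Complex; rewrite /= ?opprD. Qed.
HB.instance Definition _ := GRing.isZmodMorphism.Build (quat R) C
  quat_w quat_w_is_zmod_morphism.

Lemma quat_of_complexK q : quat_of_complex (quat_z q) (quat_w q) = q.
Proof. by apply: quatP; rewrite //= opprK. Qed.

Lemma quat_of_complex_z z w : quat_z (quat_of_complex z w) = z.
Proof. by case: z. Qed.

Lemma quat_of_complex_w z w : quat_w (quat_of_complex z w) = w.
Proof. by case: w => x y; congr Complex; rewrite /= opprK. Qed.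

Lemma quat_zM p q :
  quat_z (p * q) = quat_z p * quat_z q - conjc (quat_w p) * quat_w q.
Proof. by congr Complex => /=; ring. Qed.

Lemma quat_wM p q :
  quat_w (p * q) = quat_w p * quat_z q + conjc (quat_z p) * quat_w q.
Proof. by congr Complex => /=; ring. Qed.

Definition complex_coords m n (A : 'M[quat R]_(m, n)) : 'M[C]_(m + m, n) :=
  col_mx (map_mx quat_z A) (map_mx quat_w A).

(** If [q = z + j w], then [q j] has coordinates [- conjc w] and [conjc z], so the right half holds
    the coordinates of [A] times [j]. *)
Definition complex_rep m n (A : 'M[quat R]_(m, n)) : 'M[C]_(m + m, n + n) :=
  row_mx (complex_coords A)
    (col_mx (map_mx (fun q => - conjc (quat_w q)) A)
            (map_mx (fun q => conjc (quat_z q)) A)).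

Lemma complex_rep_mul m n k (A : 'M[quat R]_(m, n)) (B : 'M[quat R]_(n, k)) :
  complex_rep A *m complex_coords B = complex_coords (A *m B).
Proof.
rewrite mul_row_col !mul_col_mx add_col_mx.
congr col_mx; apply/matrixP => i j; rewrite !mxE raddf_sum -big_split /=;
  apply: eq_bigr => l _; rewrite !mxE ?quat_zM ?quat_wM ?mulNr //.
Qed.

Definition quat_of_coords m n (M : 'M[C]_(m + m, n)) : 'M[quat R]_(m, n) :=
  \matrix_(i, j) quat_of_complex (usubmx M i j) (dsubmx M i j).

Lemma quat_of_coordsK m n :
  cancel (@quat_of_coords m n) (@complex_coords m n).
Proof.
move=> M; rewrite -[RHS]vsubmxK; congr col_mx; apply/matrixP => i j.
  by rewrite [LHS]mxE [quat_of_coords M i j]mxE quat_of_complex_z.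
by rewrite [LHS]mxE [quat_of_coords M i j]mxE quat_of_complex_w.
Qed.

Lemma complex_coordsK m n :
  cancel (@complex_coords m n) (@quat_of_coords m n).
Proof.
move=> A; apply/matrixP => i j; rewrite mxE col_mxKu col_mxKd !mxE.
exact: quat_of_complexK.
Qed.

(** The identity is transported to complex matrices, where commutativity of the scalars gives
    [mulmx1C], and back by injectivity of [complex_coords]. *)
Lemma quat_mulmx1C n (A B : 'M[quat R]_n) : A *m B = 1%:M -> B *m A = 1%:M.
Proof.
move=> AB1; have repAB : complex_rep A *m complex_rep B = 1%:M.
  (* [complex_rep_mul] only applies to coordinate matrices, so the complex identity matrix is first
     written as one. *)
  rewrite -[complex_rep B]mulmx1 -[X in _ *m (_ *m X)](quat_of_coordsK (m := n)).
  by rewrite !complex_rep_mul mulmxA AB1 mul1mx quat_of_coordsK.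
apply: (can_inj (@complex_coordsK n n)); rewrite -complex_rep_mul.
rewrite -[X in _ *m complex_coords X]mulmx1 -complex_rep_mul mulmxA.
by rewrite (mulmx1C repAB) mul1mx.
Qed.

(** A complex eigenvector gives [A x = x l] with [l] complex. Then [x^* A x = |x|^2 l] is
    self-adjoint, which forces [l] to be real. *)
Lemma hermitian_eigenvector n (A : 'M[quat R]_n) : (0 < n)%N ->
  quat_adjmx A = A ->
  exists r : R, exists2 x : 'cV[quat R]_n,
    x != 0 & A *m x = real_quat r *: x.
Proof.
move=> n0 Ah; have nn0 : (0 < n + n)%N by rewrite addn_gt0 n0.
(* [eigenvalueP] yields row eigenvectors, hence the transpose. *)
have [l /eigenvalueP [v vl v0]] := eigenvalue_closed ((complex_rep A)^T) nn0.
have [x xE] : exists x : 'cV[quat R]_n, complex_coords x = v^T.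
  by exists (quat_of_coords v^T); rewrite quat_of_coordsK.
have x0 : x != 0.
  apply: contraNneq v0 => x0; rewrite -[v]trmxK -xE x0.
  by apply/eqP/matrixP => i j; rewrite !mxE; case: splitP => k _; rewrite !mxE raddf0.
have Axl : A *m x = x *m (quat_of_complex l 0)%:M.
  apply: (can_inj (@complex_coordsK _ _)); rewrite -complex_rep_mul xE.
  rewrite -[complex_rep A]trmxK -trmx_mul vl linearZ /= -xE.
  rewrite /complex_coords scale_col_mx.
  congr col_mx; apply/matrixP => i j; rewrite !mxE big_ord1 !mxE ord1 mulr1n.
    by rewrite quat_zM quat_of_complex_z quat_of_complex_w mulr0 subr0 mulrC.
  by rewrite quat_wM quat_of_complex_z quat_of_complex_w mulr0 addr0 mulrC.
have xAx : quat_adjmx x *m A *m x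
         = (real_quat (sqnorm_col x) * quat_of_complex l 0)%:M.
  by rewrite -mulmxA Axl mulmxA quat_adjmx_mul_col -scalar_mxM.
have l_im : complex.Im l = 0.
  have /matrixP /(_ 0 0) : quat_adjmx (quat_adjmx x *m A *m x)
                         = quat_adjmx x *m A *m x.
    by rewrite !quat_adjmxM quat_adjmxK Ah mulmxA.
  rewrite xAx !mxE !mulr1n => /(congr1 (@qc1 R)) /= /eqP.
  rewrite !mul0r !(subr0, addr0) -subr_eq0 -opprD oppr_eq0 -mulr2n mulrn_eq0 /=.
  by rewrite mulf_eq0 sqnorm_col_eq0 (negPf x0) => /eqP.
exists (complex.Re l), x => //; rewrite Axl -quat_mulmx_scalar.
by congr (_ *m _%:M); apply: quatP; rewrite //= ?l_im ?oppr0.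
Qed.

End ComplexRepresentation.

(** * Unitary diagonalization of Hermitian quaternion matrices *)

Section Diagonalization.
Set Implicit Arguments.
Unset Strict Implicit.
Variable R : rcfType.

(** Take [q = conj_quat p / |p|], or [1] when [p = 0]. *)
Lemma unit_phase (p : quat R) :
  exists q : quat R, [/\ q * conj_quat q = 1, conj_quat q * q = 1
    & exists2 r : R, 0 <= r & p * q = real_quat r].
Proof.
have [->|p0] := eqVneq p 0.
  exists 1; rewrite -(rmorph1 (@real_quat R)) conj_real_quat -rmorphM mulr1.
  by split=> //; exists 0; rewrite // rmorph0 mul0r.
have s0 : 0 < norm_quat p by rewrite sqrtr_gt0 sqnorm_quat_gt0.
have s2 : sqnorm_quat p = norm_quat p ^+ 2.
  by rewrite sqr_sqrtr ?sqnorm_quat_ge0.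
have conjE : conj_quat (real_quat (norm_quat p)^-1 * conj_quat p)
           = real_quat (norm_quat p)^-1 * p.
  by rewrite conj_quatM conj_real_quat conj_quatK real_quatC.
exists (real_quat (norm_quat p)^-1 * conj_quat p); rewrite conjE !real_quatMM.
rewrite mul_conj_quat mul_quat_conj s2 -rmorphM -invfM -expr2.
rewrite mulVf ?expf_neq0 ?gt_eqF // rmorph1; split=> //.
exists (norm_quat p); first exact: ltW.
rewrite mulrA -real_quatC -mulrA mul_quat_conj s2 -rmorphM expr2.
by rewrite mulKf ?gt_eqF.
Qed.

(* [H] is the reflection [1 - 2 w w^* / (w^* w)] with [w = y + e_k], where [y]
   is [x] times a unit quaternion chosen so that [y_k] is real and
   nonnegative. *)
Lemma householder n (k : 'I_n) (x : 'cV[quat R]_n) :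
  quat_adjmx x *m x = 1%:M ->
  exists2 H : 'M[quat R]_n, quat_adjmx H = H /\ H *m H = 1%:M
    & exists2 q : 'M[quat R]_1, q *m quat_adjmx q = 1%:M
      & H *m delta_mx k 0 = x *m q.
Proof.
move=> x1; have [p [pp' p'p [r r0 xkp]]] := unit_phase (x k 0).
pose q : 'M[quat R]_1 := p%:M; pose e : 'cV[quat R]_n := delta_mx k 0.
have qadj : quat_adjmx q = (conj_quat p)%:M.
  by apply/matrixP => i j; rewrite !mxE !ord1 eqxx !mulr1n.
have qq' : q *m quat_adjmx q = 1%:M by rewrite qadj -scalar_mxM pp'.
have q'q : quat_adjmx q *m q = 1%:M by rewrite qadj -scalar_mxM p'p.
pose y := x *m q; pose w := y + e.
have yk : y k 0 = real_quat r by rewrite mxE big_ord1 mxE mulr1n.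
have ey : quat_adjmx e *m y = (real_quat r)%:M.
  rewrite quat_adjmx_delta -rowE; apply/matrixP => i j.
  by rewrite !ord1 mxE yk mxE mulr1n.
have y1 : quat_adjmx y *m y = 1%:M.
  by rewrite quat_adjmxM mulmxA -(mulmxA (quat_adjmx q)) x1 mulmx1.
have e1 : quat_adjmx e *m e = 1%:M.
  by rewrite quat_adjmx_delta mul_delta_mx; apply/matrixP => i j;
     rewrite !ord1 !mxE !eqxx.
have ye : quat_adjmx y *m e = (real_quat r)%:M.
  rewrite -[e]quat_adjmxK -quat_adjmxM ey; apply/matrixP => i j.
  by rewrite !ord1 !mxE eqxx mulr1n conj_real_quat.
have we : quat_adjmx w *m e = (real_quat (1 + r))%:M.
  by rewrite raddfD mulmxDl ye e1 addrC [in RHS]raddfD raddfD rmorph1.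
have ww : quat_adjmx w *m w = (real_quat (2 * (1 + r)))%:M.
  rewrite mulmxDr we raddfD mulmxDl /= y1 ey.
  by rewrite mulr_natl mulr2n !raddfD /= rmorph1.
(* This is where [0 <= r] matters: it keeps [w] from vanishing. *)
have r1 : 1 + r != 0 by rewrite gt_eqF // ltr_wpDr.
pose P := real_quat (1 + r)^-1 *: (w *m quat_adjmx w).
have PP : P *m P = P + P.
  rewrite -scalemxAl real_scalemxAr mulmxA -(mulmxA w) ww quat_mulmx_scalar.
  rewrite -scalemxAl !scalerA -!rmorphM -scalerDl -raddfD; congr (real_quat _ *: _).
  by rewrite -mulrA [_^-1 * (2 * _)]mulrC mulfK // mulrC mulr_natl mulr2n.
have Ph : quat_adjmx P = P by rewrite quat_adjmxZ quat_adjmxM quat_adjmxK.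
exists (1%:M - P).
  split; first by rewrite raddfB /= quat_adjmx1 Ph.
  rewrite mulmxBl mul1mx mulmxBr mulmx1 PP opprB.
  by rewrite addrK subrK.
(* Since [P e = w = y + e], the reflection sends [e] to [- y], hence the sign. *)
exists (- q); first by rewrite raddfN mulmxN mulNmx opprK.
rewrite mulmxBl mul1mx -scalemxAl -mulmxA we quat_mulmx_scalar scalerA.
by rewrite -rmorphM mulVf // rmorph1 scale1r opprD addrCA subrr addr0 mulmxN.
Qed.

Lemma normalize_col n (x : 'cV[quat R]_n) : x != 0 ->
  exists2 r : R, r != 0 & quat_adjmx (real_quat r *: x) *m (real_quat r *: x) = 1%:M.
Proof.
rewrite -sqnorm_col_gt0 => x0; exists (Num.sqrt (sqnorm_col x))^-1.
  by rewrite invr_neq0 // gt_eqF // sqrtr_gt0.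
rewrite quat_adjmxZ -scalemxAl real_scalemxAr scalerA quat_adjmx_mul_col.
rewrite -rmorphM scale_scalar_mx -rmorphM -invfM -expr2 sqr_sqrtr ?ltW //.
by rewrite mulVf ?rmorph1 // gt_eqF.
Qed.

(** Induction on the size: conjugating by a reflection that sends the first basis vector to a unit
    eigenvector, up to a unit quaternion, splits off a real [1 x 1] block. *)
Theorem hermitian_unitary_diag n (A : 'M[quat R]_n) : quat_adjmx A = A ->
  exists2 U : 'M[quat R]_n, quat_unitarymx U
    & exists l : 'rV[R]_n,
        quat_adjmx U *m A *m U = diag_mx (map_mx (@real_quat R) l).
Proof.
elim: n => [|n IHn] in A *.
  by move=> _; exists 1%:M; [|exists 0]; apply/matrixP => -[].
move: A; rewrite -[n.+1]/(1 + n)%N => A Ah.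
have [r [x x0 Ax]] := hermitian_eigenvector (ltn0Sn n) Ah.
have [s s0 x1] := normalize_col x0.
have [H [Hh HH] [q _ He]] := householder (n := 1 + n) 0 x1.
have AHe : H *m A *m H *m delta_mx 0 0
         = real_quat r *: (delta_mx 0 0 : 'cV[quat R]_(1 + n)).
  rewrite -mulmxA He mulmxA -(mulmxA H) real_scalemxAr Ax scalerA -rmorphM.
  rewrite mulrC rmorphM -scalerA !real_scalemxAr -!scalemxAl.
  rewrite -[X in _ = _ *: X]mul1mx -HH -(mulmxA H H) He.
  by rewrite -!scalemxAl real_scalemxAr mulmxA.
have [B defB] : exists B : 'M[quat R]_(1 + n), B = H *m A *m H.
  by exists (H *m A *m H).
have Bh : quat_adjmx B = B by rewrite defB !quat_adjmxM Ah Hh mulmxA.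
have B0 i : B i 0 = real_quat r *+ (i == 0).
  move/matrixP/(_ i 0): AHe; rewrite -defB -colE !mxE andbT => ->.
  by case: (i == 0); rewrite ?mulr1 ?mulr0.
(* The first column of [B] is known from [B0]; the rest of the first row vanishes because [B] is
   Hermitian. *)
have BE : B = block_mx (real_quat r)%:M 0 0 (drsubmx B).
  rewrite -[LHS]submxK; congr block_mx; apply/matrixP => i j.
  - by rewrite !ord1 !mxE !lshift0 B0 !mulr1n.
  - rewrite !ord1 -{1}Bh 2!mxE /usubmx !mxE lshift0 B0 -(inj_eq val_inj) /=.
    by rewrite raddf0.
  - by rewrite !ord1 !mxE lshift0 B0.
have B'h : quat_adjmx (drsubmx B) = drsubmx B.
  by rewrite /quat_adjmx /quat_conjmx map_drsubmx trmx_drsub -/(quat_adjmx B) Bh.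
have [U' U'1 [l U'B]] := IHn _ B'h.
pose V : 'M[quat R]_(1 + n) := block_mx 1%:M 0 0 U'.
have Vadj : quat_adjmx V = block_mx 1%:M 0 0 (quat_adjmx U').
  rewrite /quat_adjmx /quat_conjmx map_block_mx tr_block_mx.
  by rewrite !(map_mx0, trmx0) -/(quat_conjmx _) -/(quat_adjmx _) quat_adjmx1.
exists (H *m V).
  rewrite /quat_unitarymx quat_adjmxM Hh mulmxA -(mulmxA (quat_adjmx V)) HH.
  rewrite mulmx1 Vadj /V mulmx_block !(mulmx1, mulmx0, mul0mx, addr0, add0r).
  by rewrite U'1 -scalar_mx_block.
exists (row_mx (\row_(j < 1) r) l).
have -> : quat_adjmx (H *m V) *m A *m (H *m V) = quat_adjmx V *m B *m V.
  by rewrite quat_adjmxM Hh defB !mulmxA.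
rewrite BE Vadj /V !mulmx_block !(mulmx1, mul1mx, mulmx0, mul0mx, addr0, add0r).
rewrite U'B map_row_mx diag_mx_row; congr block_mx.
by apply/matrixP => i j; rewrite !ord1 !mxE.
Qed.

(** The eigenvector is column [i] of [U], nonzero because the diagonal entry of [U^* U] at [i] is
    [1]. *)
Lemma unitary_diag_right_eigenvalue n (A U : 'M[quat R]_n) (l : 'rV[R]_n) i :
  quat_unitarymx U ->
  quat_adjmx U *m A *m U = diag_mx (map_mx (@real_quat R) l) ->
  right_eigenvalue A (real_quat (l 0 i)).
Proof.
move=> U1 UAU; exists (col i U).
  apply/eqP => /colP Ui0; move/matrixP/(_ i i)/eqP: U1.
  rewrite !mxE eqxx big1 => [|j _]; first by rewrite eq_sym oner_eq0.
  by have := Ui0 j; rewrite !mxE => ->; rewrite mulr0.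
have AU : A *m U = U *m diag_mx (map_mx (@real_quat R) l).
  by rewrite -UAU !mulmxA (quat_mulmx1C U1) mul1mx.
have -> : A *m col i U = col i (A *m U) by rewrite !colE mulmxA.
by rewrite AU mul_mx_diag; apply/colP => j; rewrite !mxE.
Qed.

Lemma perm_right_eigenvalues n (l : 'rV[R]_n) :
  exists p : 'S_n, forall i j : 'I_n, (i <= j)%N -> l 0 (p j) <= l 0 (p i).
Proof.
pose t := [tuple l 0 i | i < n]; pose s := sort (fun x y : R => y <= x) t.
have [p sE] := tuple_permP (permEl (perm_sort (fun x y : R => y <= x) t)).
have s_sorted : sorted (fun x y : R => y <= x) s.
  by apply: sort_sorted => x y; apply: le_total.
exists p => i j ij; rewrite leq_eqVlt in ij; case/predU1P: ij => [/val_inj -> //|ij].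
have trans : transitive (fun x y : R => y <= x).
  by move=> x y z yx zy; apply: le_trans zy yx.
have := sorted_ltn_nth trans 0 s_sorted.
move=> /(_ i j); rewrite !inE /s sE size_tuple !ltn_ord => /(_ isT isT ij).
by rewrite -!tnth_nth !tnth_mktuple.
Qed.

(** Permuting the columns of a diagonalizing unitary keeps it unitary and permutes the diagonal,
    which can thus be sorted. *)
Theorem hermitian_right_eigenvalues n (A : 'M[quat R]_n) : quat_adjmx A = A ->
  exists l, right_eigenvalues_with_mult A l.
Proof.
move=> /hermitian_unitary_diag [U U1 [l UAU]].
have [p l_sorted] := perm_right_eigenvalues l.
pose V := colsub p U; pose l' := colsub p l.
have VBV B : quat_adjmx V *m B *m V = mxsub p p (quat_adjmx U *m B *m U).
  have -> : quat_adjmx V = rowsub p (quat_adjmx U).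
    by apply/matrixP => i j; rewrite !mxE.
  rewrite mul_rowsub_mx mul_rowsub_mx mulmx_colsub.
  by apply/matrixP => i j; rewrite !mxE.
have V1 : quat_unitarymx V.
  have := VBV 1%:M; rewrite !mulmx1 U1 => VV; rewrite /quat_unitarymx VV.
  by apply/matrixP => i j; rewrite !mxE (inj_eq perm_inj).
have VAV : quat_adjmx V *m A *m V = diag_mx (map_mx (@real_quat R) l').
  by rewrite VBV UAU; apply/matrixP => i j; rewrite !mxE (inj_eq perm_inj).
exists l'; split=> [i|i j ij|].
- exact: unitary_diag_right_eigenvalue V1 VAV.
- by rewrite !mxE l_sorted.
- by exists V.
Qed.

End Diagonalization.

(** * Right eigenvalues of Gram matrices and of scalar matrices minus a rank-one term *)

Section GramMatrices.
Set Implicit Arguments.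
Unset Strict Implicit.
Variable R : rcfType.

Lemma right_eigenvalue_realP n (A : 'M[quat R]_n) (r : R) :
  right_eigenvalue A (real_quat r) <->
  exists2 x : 'cV[quat R]_n, x != 0 & A *m x = real_quat r *: x.
Proof.
by split=> -[x x0 Ax]; exists x => //; rewrite Ax; apply/colP => i;
   rewrite !mxE real_quatC.
Qed.

(** In the coordinates [y = U^* x] the matrix is diagonal, so any nonzero entry of [y] identifies
    [r] with the diagonal entry at that index. *)
Lemma right_eigenvalues_complete n (A : 'M[quat R]_n) l (r : R) :
  right_eigenvalues_with_mult A l -> right_eigenvalue A (real_quat r) ->
  exists i, l 0 i = r.
Proof.
case=> _ _ [U U1 UAU] /right_eigenvalue_realP [x x0 Ax].
have UU' := quat_mulmx1C U1.
have [y yE] : exists y, y = quat_adjmx U *m x by exists (quat_adjmx U *m x).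
have Dy : diag_mx (map_mx (@real_quat R) l) *m y = real_quat r *: y.
  rewrite -UAU yE -mulmxA (mulmxA U) UU' mul1mx -mulmxA Ax.
  by rewrite real_scalemxAr.
have /cV0Pn [i yi0] : y != 0.
  by apply: contraNneq x0 => y0; rewrite -[x]mul1mx -UU' -mulmxA -yE y0 mulmx0.
have yi_unit : y i 0 \is a GRing.unit by [].
exists i; move/colP/(_ i): Dy; rewrite mul_diag_mx !mxE.
by move/(mulIr yi_unit) => [].
Qed.

Lemma gram_right_eigenvalue_gt0 n (Z : 'M[quat R]_n) (r : R) :
  (forall x : 'cV[quat R]_n, quat_adjmx Z *m x = 0 -> x = 0) ->
  right_eigenvalue (Z *m quat_adjmx Z) (real_quat r) -> 0 < r.
Proof.
move=> Zinj /right_eigenvalue_realP [x x0 Zx].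
have Zx0 : quat_adjmx Z *m x != 0 by apply: contraNneq x0 => /Zinj ->.
have : quat_adjmx x *m (Z *m quat_adjmx Z *m x)
     = quat_adjmx (quat_adjmx Z *m x) *m (quat_adjmx Z *m x).
  by rewrite quat_adjmxM quat_adjmxK !mulmxA.
rewrite Zx real_scalemxAr !quat_adjmx_mul_col scale_scalar_mx -rmorphM.
move/matrixP/(_ 0 0); rewrite !mxE !mulr1n => -[rx].
by rewrite -(pmulr_lgt0 r (_ : 0 < sqnorm_col x)) ?rx sqnorm_col_gt0.
Qed.

Lemma scalar_minus_rank1_eigenvalues n (W : 'M[quat R]_n.+1)
    (x : 'cV[quat R]_n.+1) (s : R) :
  0 < s -> quat_adjmx x *m x = 1%:M ->
  W = real_quat s *: (1%:M - x *m quat_adjmx x) ->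
  right_eigenvalues_with_mult W (\row_i (if i == ord_max then 0 else s)).
Proof.
(* The last basis vector is chosen so that the eigenvalue [0] comes last in nonincreasing order. *)
move=> s0 x1 WE; have [H [Hh HH] [q qq' He]] := householder ord_max x1.
have H1 : quat_unitarymx H by rewrite /quat_unitarymx Hh.
have HWH : quat_adjmx H *m W *m H = diag_mx (map_mx (@real_quat R)
    (\row_i (if i == ord_max then 0 else s))).
  (* [H] is an involution, so it sends [x] back to the basis vector, up to the unit [q], which
     cancels in [x x^*]. *)
  have Hx : H *m x = delta_mx ord_max 0 *m quat_adjmx q.
    by rewrite -[x]mulmx1 -qq' !mulmxA -(mulmxA H) -He !mulmxA HH mul1mx.
  have HxxH : H *m (x *m quat_adjmx x) *m H = delta_mx ord_max ord_max.
    have -> : H *m (x *m quat_adjmx x) *m H = (H *m x) *m quat_adjmx (H *m x).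
      by rewrite quat_adjmxM Hh !mulmxA.
    rewrite Hx quat_adjmxM quat_adjmxK mulmxA -(mulmxA _ (quat_adjmx q)).
    by rewrite (quat_mulmx1C qq') mulmx1 quat_adjmx_delta mul_delta_mx.
  rewrite Hh WE real_scalemxAr -scalemxAl mulmxBr mulmxBl mulmx1 HH HxxH.
  apply/matrixP => i j; rewrite !mxE.
  have [->|ij] := eqVneq i j; last first.
    case: (eqVneq i ord_max) ij => [->|_ _]; last by rewrite subr0 mulr0.
    by rewrite eq_sym => /negPf ->; rewrite subr0 mulr0.
  rewrite andbb; case: (j == ord_max); rewrite ?subrr ?subr0.
    by rewrite mulr0 rmorph0.
  by rewrite mulr1.
split; last by exists H.
  by move=> i; apply: unitary_diag_right_eigenvalue H1 HWH.
move=> i j ij; rewrite !mxE; case: (eqVneq i ord_max) => [im|_].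
  rewrite ifT // -(inj_eq val_inj) /= eqn_leq -ltnS ltn_ord /=.
  by move: ij; rewrite im.
by case: ifP => _ //; apply: ltW.
Qed.

End GramMatrices.

(** * The skew-symmetric matrix of order three and its Gram matrix *)

Section SkewMatrix.
Set Implicit Arguments.
Unset Strict Implicit.
Variable R : rcfType.
Implicit Types a b c : quat R.

Lemma conj_skewmx3 a b c :
  quat_adjmx (skewmx3 a b c) = - quat_conjmx (skewmx3 a b c).
Proof.
apply/matrixP => -[[|[|[|i]]] Hi] [[|[|[|j]]] Hj] //; rewrite !mxE /=;
  by rewrite ?raddfN ?raddf0 ?opprK ?oppr0.
Qed.

(** The inverse of [a] is its conjugate over the central factor [|a|^2], which cancels and leaves a
    condition polynomial in the components. *)
Lemma quat_inv_commP a b c : a != 0 ->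
  c * a^-1 * b = b * a^-1 * c <-> c * conj_quat a * b = b * conj_quat a * c.
Proof.
move=> a0; rewrite quat_inv !mulrA -2!(real_quatC (sqnorm_quat a)^-1) -!mulrA.
have u : real_quat (sqnorm_quat a)^-1 \is a GRing.unit.
  by apply/eqP => -[] /eqP; rewrite invr_eq0 sqnormq_eq0 (negPf a0).
by split=> [/(mulrI u)|->].
Qed.

(** The first two equations express [x1] and [x0] through [x2]. The third, scaled by [|a|^2],
    becomes [d x2 = 0], where [d] is the difference in [nd'], nonzero by conjugating the
    hypothesis. *)
Lemma skewmx3_adj_inj a b c : a != 0 ->
  c * a^-1 * b <> b * a^-1 * c ->
  forall x : 'cV[quat R]_3, quat_adjmx (skewmx3 a b c) *m x = 0 -> x = 0.
Proof.
move=> a0 nd x Zx.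
have nd' : conj_quat c * a * conj_quat b - conj_quat b * a * conj_quat c != 0.
  rewrite subr_eq0; apply/eqP => /(congr1 (@conj_quat R)).
  rewrite !conj_quatM !conj_quatK !mulrA => /esym.
  by rewrite -quat_inv_commP.
have au : real_quat (sqnorm_quat a) \is a GRing.unit.
  by apply/eqP => -[] /eqP; rewrite sqnormq_eq0 (negPf a0).
pose x0 := x ord0 0; pose x1 := x (lift ord0 ord0) 0.
pose x2 := x (lift ord0 (lift ord0 ord0)) 0.
have eqZ (i : 'I_3) : \sum_j quat_adjmx (skewmx3 a b c) i j * x j 0 = 0.
  by move/colP/(_ i): Zx; rewrite !mxE.
have eq0 : conj_quat a * x1 = - (conj_quat c * x2).
  have := eqZ ord0; rewrite !big_ord_recl big_ord0 !mxE /= -/x0 -/x1 -/x2.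
  rewrite !raddfN raddf0.
  rewrite mul0r add0r addr0 !mulNr => /eqP.
  by rewrite -opprD oppr_eq0 addr_eq0 => /eqP.
have eq1 : conj_quat a * x0 = conj_quat b * x2.
  have := eqZ (lift ord0 ord0); rewrite !big_ord_recl big_ord0 !mxE /=.
  rewrite -/x0 -/x1 -/x2 !raddfN raddf0 mul0r add0r addr0 mulNr => /eqP.
  by rewrite subr_eq0 => /eqP.
have eq2 : conj_quat c * x0 = - (conj_quat b * x1).
  have := eqZ (lift ord0 (lift ord0 ord0)).
  rewrite !big_ord_recl big_ord0 !mxE /= -/x0 -/x1 -/x2 raddf0.
  by rewrite mul0r !addr0 => /eqP; rewrite addr_eq0 => /eqP.
have nx0 : real_quat (sqnorm_quat a) * x0 = a * conj_quat b * x2.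
  by rewrite -mul_quat_conj -mulrA eq1 mulrA.
have nx1 : real_quat (sqnorm_quat a) * x1 = - (a * conj_quat c * x2).
  by rewrite -mul_quat_conj -mulrA eq0 mulrN mulrA.
have x2_0 : x2 = 0.
  have ndu : conj_quat c * a * conj_quat b - conj_quat b * a * conj_quat c
    \is a GRing.unit by [].
  apply: (mulrI ndu); rewrite mulr0 mulrBl.
  apply/eqP; rewrite subr_eq0 -!mulrA (mulrA a (conj_quat b)) -nx0.
  rewrite (mulrA a) -[a * _ * x2]opprK -nx1 mulrN.
  by rewrite !(mulrA _ (real_quat _)) -!real_quatC -!mulrA eq2 mulrN.
have x0_0 : x0 = 0 by apply: (mulrI au); rewrite nx0 x2_0 !mulr0.
have x1_0 : x1 = 0 by apply: (mulrI au); rewrite nx1 x2_0 !mulr0 oppr0.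
apply/colP => i; rewrite mxE.
case: (unliftP ord0 i) => [j|] ->; last exact: x0_0.
by case: (unliftP ord0 j) => [k|] ->; rewrite ?(ord1 k).
Qed.

Lemma skewmx3_gram a b c (i j : 'I_3) :
  (skewmx3 a b c *m quat_adjmx (skewmx3 a b c)) i j =
  (nth [::] [::
    [:: real_quat (sqnorm_quat a + sqnorm_quat c); c * conj_quat b; - (a * conj_quat b)];
    [:: b * conj_quat c; real_quat (sqnorm_quat a + sqnorm_quat b); a * conj_quat c];
    [:: - (b * conj_quat a); c * conj_quat a; real_quat (sqnorm_quat b + sqnorm_quat c)]] i)`_j.
Proof.
rewrite !mxE !big_ord_recl big_ord0 !mxE /=.
by case: i j => -[|[|[|i]]] Hi [[|[|[|j]]] Hj] //=; apply: quatP;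
  rewrite /= /sqnorm_quat; ring.
Qed.

(* Up to the factor [t], [u] is a nonzero column of [s - W]. *)
Lemma skewmx3_gram_rank1 a b c : ~ (a = 0 /\ b = 0 /\ c = 0) ->
  (a <> 0 -> c * conj_quat a * b = b * conj_quat a * c) ->
  exists2 t : R, 0 < t & exists u : 'cV[quat R]_3,
    sqnorm_col u = t * (sqnorm_quat a + sqnorm_quat b + sqnorm_quat c) /\
    real_quat t *: (skewmx3 a b c *m quat_adjmx (skewmx3 a b c)) + u *m quat_adjmx u
    = (real_quat (t * (sqnorm_quat a + sqnorm_quat b + sqnorm_quat c)))%:M.
Proof.
move=> abc0 deg; have [a0|a0] := eqVneq a 0; last first.
  (* [u] is the last column of [s - W] and [t] its diagonal entry: a rank-one Hermitian matrix times
     a diagonal entry equals [u u^*] for the column [u] through that entry. *)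
  exists (sqnorm_quat a); first by rewrite sqnorm_quat_gt0.
  exists (\col_i [:: a * conj_quat b; - (a * conj_quat c); a * conj_quat a]`_i).
  (* Multiplying the conjugate of [deg] by [c] on both sides and cancelling [|c|^2] leaves only [b]
     conjugated. *)
  have rel : a * conj_quat b * c = c * conj_quat b * a.
    have [->|c0] := eqVneq c 0; first by rewrite mulr0 !mul0r.
    have cu : real_quat (sqnorm_quat c) \is a GRing.unit.
      by apply/eqP => -[] /eqP; rewrite sqnormq_eq0 (negPf c0).
    have := congr1 (@conj_quat R) (deg (elimN eqP a0)).
    rewrite !conj_quatM conj_quatK !mulrA => deg'.
    apply: (mulrI cu); rewrite [RHS]real_quatC -{1}mul_quat_conj -mul_conj_quat.
    by rewrite -!mulrA; congr (c * _); rewrite !mulrA -deg'.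
  (* Only this entry and its mirror image depend on [rel]; the other entries agree identically. *)
  have entry01 : real_quat (sqnorm_quat a) * (c * conj_quat b)
      + a * conj_quat b * conj_quat (- (a * conj_quat c)) = 0.
    rewrite raddfN /= conj_quatM conj_quatK mulrN (mulrA _ c (conj_quat a)) rel.
    by rewrite real_quatC -mul_quat_conj !mulrA subrr.
  have entry10 : real_quat (sqnorm_quat a) * (b * conj_quat c)
      + - (a * conj_quat c) * conj_quat (a * conj_quat b) = 0.
    have := congr1 (@conj_quat R) rel; rewrite !conj_quatM !conj_quatK => rel'.
    rewrite mulNr -mulrA rel' -mul_quat_conj.
    by rewrite !mulrA subrr.
  split.
    by rewrite /sqnorm_col !big_ord_recl big_ord0 !mxE /= /sqnorm_quat /=; ring.
  apply/matrixP => i j; rewrite mxE mxE skewmx3_gram !mxE big_ord1 !mxE.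
  case: i j => -[|[|[|i]]] Hi [[|[|[|j]]] Hj] //=; rewrite ?mulr1n ?mulr0n;
    first [exact: entry01 | exact: entry10
          | by apply: quatP; rewrite /= /sqnorm_quat /=; ring].
rewrite {}a0 {deg} in abc0 *; have [b0|b0] := eqVneq b 0; last first.
  (* With [a = 0] the last column of [s - W] vanishes; its first column, with diagonal entry
     [|b|^2], takes over. *)
  exists (sqnorm_quat b); first by rewrite sqnorm_quat_gt0.
  exists (\col_i [:: b * conj_quat b; - (b * conj_quat c); 0]`_i); split.
    by rewrite /sqnorm_col !big_ord_recl big_ord0 !mxE /= /sqnorm_quat /=; ring.
  apply/matrixP => i j; rewrite mxE mxE skewmx3_gram !mxE big_ord1 !mxE.
  by case: i j => -[|[|[|i]]] Hi [[|[|[|j]]] Hj] //=; rewrite ?mulr1n ?mulr0n;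
    apply: quatP; rewrite /= /sqnorm_quat /=; ring.
have c0 : c != 0 by apply/eqP => c0; apply: abc0.
(* With [a = b = 0] only the middle column of [s - W] is nonzero. *)
exists (sqnorm_quat c); first by rewrite sqnorm_quat_gt0.
exists (\col_i [:: 0; c * conj_quat c; 0]`_i); rewrite b0; split.
  by rewrite /sqnorm_col !big_ord_recl big_ord0 !mxE /= /sqnorm_quat /=; ring.
apply/matrixP => i j; rewrite mxE mxE skewmx3_gram !mxE big_ord1 !mxE.
by case: i j => -[|[|[|i]]] Hi [[|[|[|j]]] Hj] //=; rewrite ?mulr1n ?mulr0n;
  apply: quatP; rewrite /= /sqnorm_quat /=; ring.
Qed.

End SkewMatrix.

(** * The nondegenerate and degenerate spectra of [W] *)

Theorem theorem4p3 (R : realType) (a b c : quat R)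
    (habc : ~ (a = 0 /\ b = 0 /\ c = 0)) :
  let Z := skewmx3 a b c in
  let W := - (Z *m quat_conjmx Z) in
  let s := norm_quat a ^+ 2 + norm_quat b ^+ 2 + norm_quat c ^+ 2 in
  let nondegenerate := a <> 0 /\ c * a^-1 * b <> b * a^-1 * c in
  [/\ W = Z *m quat_adjmx Z,
      (exists2 l : 'rV[R]_3, right_eigenvalues_with_mult W l
         & forall i, 0 < l 0 i) <-> nondegenerate
    & ~ nondegenerate ->
      0 < s /\ right_eigenvalues_with_mult W (\row_(i < 3) [:: s; s; 0]`_i)].
Proof.
move=> Z W s nd.
have WE : W = Z *m quat_adjmx Z by rewrite conj_skewmx3 mulmxN.
have sE : s = sqnorm_quat a + sqnorm_quat b + sqnorm_quat c.
  by rewrite /s !sqr_sqrtr // sqnorm_quat_ge0.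
have degW : ~ nd ->
    0 < s /\ right_eigenvalues_with_mult W (\row_(i < 3) [:: s; s; 0]`_i).
  move=> ndN.
  have deg : a <> 0 -> c * conj_quat a * b = b * conj_quat a * c.
    move=> a0; apply/(quat_inv_commP b c (introN eqP a0)).
    by apply: contrapT => cab; apply: ndN.
  have s_gt0 : 0 < s.
    have ge0 := @sqnorm_quat_ge0 R; have ab_ge0 := addr_ge0 (ge0 a) (ge0 b).
    rewrite sE lt0r (addr_ge0 ab_ge0 (ge0 c)) andbT.
    rewrite (paddr_eq0 ab_ge0 (ge0 c)) (paddr_eq0 (ge0 a) (ge0 b)) !sqnormq_eq0.
    by apply/negP => /andP[/andP[/eqP a0 /eqP b0] /eqP c0]; apply: habc.
  split=> //.
  have [t t0 [u []]] := skewmx3_gram_rank1 habc deg.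
  rewrite -sE -/Z -WE => u2 Wu.
  (* Since [|u|^2 = t s], this makes [x] a unit vector with [s x x^* = s - W]. *)
  pose r := (Num.sqrt (t * s))^-1; pose x := real_quat r *: u.
  have ts0 : 0 < t * s by rewrite mulr_gt0.
  have r2 : r * r = (t * s)^-1 by rewrite -invfM -expr2 sqr_sqrtr ?ltW.
  have xx : x *m quat_adjmx x = real_quat (t * s)^-1 *: (u *m quat_adjmx u).
    by rewrite quat_adjmxZ -scalemxAl real_scalemxAr scalerA -rmorphM r2.
  have x1 : quat_adjmx x *m x = 1%:M.
    rewrite quat_adjmxZ -scalemxAl real_scalemxAr scalerA -rmorphM r2.
    rewrite quat_adjmx_mul_col u2 scale_scalar_mx -rmorphM mulVf ?rmorph1 //.
    exact: lt0r_neq0.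
  have -> : \row_(i < 3) [:: s; s; 0]`_i = \row_i (if i == ord_max then 0 else s).
    by apply/rowP => -[[|[|[|i]]] Hi] //; rewrite !mxE.
  apply: scalar_minus_rank1_eigenvalues s_gt0 x1 _.
  have uu : u *m quat_adjmx u = (real_quat (t * s))%:M - real_quat t *: W.
    by rewrite -Wu addrAC subrr add0r.
  rewrite xx uu (scalerBr (real_quat (t * s)^-1)) scale_scalar_mx -rmorphM.
  rewrite mulVf ?lt0r_neq0 // rmorph1.
  rewrite scalerA -rmorphM opprB addrCA subrr addr0 scalerA -rmorphM.
  by rewrite mulrCA (mulrC s t) mulVf ?lt0r_neq0 // rmorph1 scale1r.
split=> //; split=> [[l Wl l0]|[/eqP a0 cab]]; last first.
  have [l Wl] : exists l, right_eigenvalues_with_mult W l.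
    apply: hermitian_right_eigenvalues.
    by rewrite WE quat_adjmxM quat_adjmxK.
  exists l => // i; have [Wl_eig _ _] := Wl.
  by apply: (gram_right_eigenvalue_gt0 (skewmx3_adj_inj a0 cab)); rewrite -WE.
(* In the degenerate case [0] is a right eigenvalue of [W], hence an entry of [l], against
   positivity. *)
have [//|/degW [_ [W0 _ _]]] := pselect nd.
have [i li] := right_eigenvalues_complete Wl (W0 ord_max).
by have := l0 i; rewrite li mxE ltxx.
Qed.
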